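(* Let $p_n(a,x)$ be the polynomials defined by $p_{-1}(a,x)=0$ and $p_{k+1}(a,x)=2\big((k+1-a)x+a\big)p_k(a,x)+2x(1-x)p_k'(a,x)+q_k(x)$, where $q_{-1}(x)=1$ and $q_{k+1}(x)=(2(k+1)x+1)q_k(x)+2x(1-x)q_k'(x)$ (derivatives in $x$). Then for every $n\in\mathbb{Z}_{\ge0}$, $a\in\mathbb{R}\setminus\frac12\mathbb{Z}_{\le1}$ and $|z|<1$, \[ p_n(a,z)=2^n\sum_{j=0}^{n}\sum_{l=0}^{j}\binom{n+1}{j+1}\binom{j}{l}(a-1)^{j-l}(1-z)^{j-l}E_{n-j}\!\left(z,\tfrac12\right)E_l\!\left(z,\tfrac12\right). \]
   Context: The bivariate Eulerian polynomials $E_n(x,y)$ are defined by the generating function $\sum_{n\ge0}E_n(x,y)\frac{t^n}{n!}=\left(\frac{1-x}{e^{t(x-1)}-x}\right)^{y}$. *)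

(* Defs.v *)
From HB Require Import structures.
From mathcomp Require Export all_boot all_order all_algebra.
From mathcomp Require Export reals.
From mathcomp Require Export complex.

Set Implicit Arguments.
Unset Strict Implicit.
Unset Printing Implicit Defensive.

Import GRing.Theory Num.Theory.
Local Open Scope ring_scope.

(* A formal power series \sum_n f_n t^n is represented by its coefficient
   sequence f : nat -> K. *)
Section FormalPowerSeries.
Variable K : fieldType.
Implicit Types (f g : nat -> K) (c y : K) (n k : nat).

Definition fps_const c : nat -> K := fun n => if n is 0%N then c else 0.

Definition fps_sub f g : nat -> K := fun n => f n - g n.

Definition fps_mul f g : nat -> K :=
  fun n => \sum_(i < n.+1) f i * g (n - i)%N.

(* The first n coefficients of 1 / f, obtained by solving f * g = 1; only
   meaningful when f 0 != 0. *)
Fixpoint fps_inv_seq f n : seq K :=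
  if n is m.+1 then
    let s := fps_inv_seq f m in
    rcons s ((f 0%N)^-1 * ((m == 0%N)%:R - \sum_(i < m) f (m - i)%N * s`_i))
  else [::].

Definition fps_inv f : nat -> K := fun n => (fps_inv_seq f n.+1)`_n.

Definition fps_div f g : nat -> K := fps_mul f (fps_inv g).

(* e^{ct} *)
Definition fps_exp c : nat -> K := fun n => c ^+ n / n`!%:R.

Definition gbinom y k : K := (\prod_(i < k) (y - i%:R)) / k`!%:R.

(* f^y = \sum_k binom(y, k) (f - 1)^k for f with constant coefficient 1.
   Then t^k divides (f - 1)^k, so only the terms k <= n contribute to the
   coefficient of t^n. *)
Definition fps_pow f y : nat -> K := fun n =>
  \sum_(k < n.+1)
    gbinom y k * iter k (fps_mul (fps_sub f (fps_const 1))) (fps_const 1) n.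

Lemma size_fps_inv_seq f n : size (fps_inv_seq f n) = n.
Proof. by elim: n => //= n IH; rewrite size_rcons IH. Qed.

Lemma nth_fps_inv_seq f n i : (i < n)%N -> (fps_inv_seq f n)`_i = fps_inv f i.
Proof.
elim: n => // n IH; rewrite ltnS leq_eqVlt => /orP[/eqP->//|lt_in].
by rewrite /= nth_rcons size_fps_inv_seq lt_in IH.
Qed.

Lemma fps_mulVf f : f 0%N != 0 -> fps_mul (fps_inv f) f =1 fps_const 1.
Proof.
move=> f0 n; rewrite /fps_mul big_ord_recr /= subnn.
rewrite {2}/fps_inv /= nth_rcons size_fps_inv_seq ltnn eqxx mulrAC mulVf //.
rewrite mul1r (eq_bigr (fun i : 'I_n => f (n - i)%N * (fps_inv_seq f n)`_i)).
  by rewrite addrC subrK; case: n.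
by move=> i _; rewrite nth_fps_inv_seq // mulrC.
Qed.

End FormalPowerSeries.

(* The value E_n(x, y), for x != 1, of the bivariate Eulerian polynomial:
   n! times the coefficient of t^n in ((1 - x) / (e^{t(x - 1)} - x))^y. *)
Definition eulerian_gf (K : fieldType) (x y : K) : nat -> K :=
  fps_pow
    (fps_div (fps_const (1 - x)) (fps_sub (fps_exp (x - 1)) (fps_const x))) y.

Definition eulerian (K : fieldType) (n : nat) (x y : K) : K :=
  n`!%:R * eulerian_gf x y n.

(* The recursions start at index -1: q_pred m and p_pred a m are q_{m-1} and
   p_{m-1}(a, -), so that the factor k + 1 of the step k -> k + 1 is m. *)
Fixpoint q_pred (K : fieldType) (m : nat) : {poly K} :=
  if m is k.+1 then
    (2 * k%:R *: 'X + 1) * q_pred K k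
    + 2 *: ('X * (1 - 'X)) * (q_pred K k)^`()
  else 1.

Fixpoint p_pred (K : fieldType) (a : K) (m : nat) : {poly K} :=
  if m is k.+1 then
    2 *: ((k%:R - a) *: 'X + a%:P) * p_pred a k
    + 2 *: ('X * (1 - 'X)) * (p_pred a k)^`()
    + q_pred K k
  else 0.

Definition p_poly (K : fieldType) (a : K) (n : nat) : {poly K} :=
  p_pred a n.+1.

(* Main.v *)
(* On power series in t over K[x], T = (1 - xt) d/dt - x(1 - x) d/dx is a
   derivation, and a solution of T F = r F with r in K[x] is determined by its
   constant term. The recursions say that Q = sum q_{n-1} t^n / (2^n n!) and
   P = sum p_{n-1} t^n / (2^n n!) satisfy
     T Q = Q / 2   and   T P = a (1 - x) P + Q / 2.
   Both Q^2 (e^{t(x-1)} - x) and 1 - x solve T F = x F, so they agree and Q is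
   the generating function of the E_n(x, 1/2). With c = (a - 1)(1 - x) and J
   the t-antiderivative of Q e^{ct}, one has T e^{ct} = c e^{ct}, hence
   T J = (a (1 - x) - 1/2) J + 1, and J Q / 2 solves the equation of P. The
   coefficients of P = J Q / 2 are the double sum. *)

From HB Require Import structures.
Require Import Defs.
From mathcomp Require Import boolp functions ring.
Import GRing.Theory Num.Theory.
Local Open Scope ring_scope.
Local Open Scope complex_scope.

Set Implicit Arguments.
Unset Strict Implicit.

(* A type of its own, because nat -> R carries the pointwise product. *)
Definition fps (R : Type) : Type := nat -> R.

Lemma fpsP (R : Type) (f g : fps R) : f =1 g -> f = g.
Proof. exact: funext. Qed.

(** * The ring of formal power series in t and its derivation d/dt *)

Section Ring.
Variable R : comNzRingType.
Implicit Types (f g h : fps R) (c : R) (n : nat).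

HB.instance Definition _ := GRing.Zmodule.copy (fps R) (nat -> R).

(** The product and constants are restated over a commutative ring because the coefficients will be
    polynomials in x; over a field they are convertible with [fps_mul] and [fps_const]. *)
Definition fpsM f g : fps R := fun n => \sum_(i < n.+1) f i * g (n - i)%N.
Definition fpsC c : fps R := fun n => if n is 0%N then c else 0.
Definition fpsX : fps R := fun n => (n == 1%N)%:R.

(** Coefficients below N of a product depend only on the truncations of its factors, so the ring
    laws and the product rule are inherited from polynomials. *)
Definition trunc N f : {poly R} := \poly_(i < N) f i.

Lemma coef_trunc N f n : (n < N)%N -> (trunc N f)`_n = f n.
Proof. by move=> nN; rewrite coef_poly nN. Qed.

Lemma coef_truncM N f g n : (n < N)%N ->
  (trunc N f * trunc N g)`_n = fpsM f g n.
Proof.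
move=> nN; rewrite coefM; apply: eq_bigr => i _.
rewrite !coef_trunc //; first exact: leq_ltn_trans (leq_subr _ _) nN.
exact: leq_ltn_trans (leq_ord i) nN.
Qed.

Fact fpsMC : commutative fpsM.
Proof.
move=> f g; apply: fpsP => n.
by rewrite -!(@coef_truncM n.+1) // mulrC.
Qed.

Fact fpsMA : associative fpsM.
Proof.
move=> f g h; apply: fpsP => n; pose N := n.+1.
have lt_sub i : (n - i < N)%N by rewrite ltnS leq_subr.
transitivity ((trunc N f * (trunc N g * trunc N h))`_n).
  rewrite coefM; apply: eq_bigr => i _.
  by rewrite coef_truncM // coef_trunc.
rewrite mulrA coefM; apply: eq_bigr => i _.
by rewrite coef_truncM // coef_trunc.
Qed.

Fact fpsM1 : left_id (fpsC 1) fpsM.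
Proof.
move=> f; apply: fpsP => n; rewrite /fpsM big_ord_recl subn0 mul1r big1 ?addr0 //.
by move=> i _; rewrite mul0r.
Qed.

Fact fpsMD : left_distributive fpsM +%R.
Proof.
move=> f g h; apply: fpsP => n; rewrite /fpsM -[RHS]big_split /=.
by apply: eq_bigr => i _; rewrite mulrDl.
Qed.

Fact fps1_neq0 : fpsC 1 != 0.
Proof. by apply/eqP => /(congr1 (fun f => f 0%N)) /eqP; rewrite oner_eq0. Qed.

HB.instance Definition _ :=
  GRing.Zmodule_isComNzRing.Build (fps R) fpsMA fpsMC fpsM1 fpsMD fps1_neq0.

Lemma fpsME f g n : (f * g) n = \sum_(i < n.+1) f i * g (n - i)%N.
Proof. by []. Qed.

Lemma fpsDE f g n : (f + g) n = f n + g n. Proof. by []. Qed.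
Lemma fpsNE f n : (- f) n = - f n. Proof. by []. Qed.
Lemma fpsBE f g n : (f - g) n = f n - g n. Proof. by []. Qed.

Lemma fps_sumE (I : Type) (r : seq I) (P : pred I) (F : I -> fps R) n :
  (\sum_(i <- r | P i) F i) n = \sum_(i <- r | P i) F i n.
Proof. by elim/big_rec2: _ => // i x y _ <-. Qed.

Lemma fpsCME c f n : (fpsC c * f) n = c * f n.
Proof.
rewrite fpsME big_ord_recl subn0 big1 ?addr0 //.
by move=> i _; rewrite mul0r.
Qed.

Fact fpsC_is_additive : additive fpsC.
Proof. by move=> c d; apply: fpsP => -[//|n]; rewrite fpsBE subr0. Qed.

Fact fpsC_is_monoid_morphism : monoid_morphism fpsC.
Proof. by split=> // c d; apply: fpsP => -[|n]; rewrite fpsCME //= mulr0. Qed.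

HB.instance Definition _ := GRing.isZmodMorphism.Build R (fps R) fpsC fpsC_is_additive.
HB.instance Definition _ := GRing.isMonoidMorphism.Build R (fps R) fpsC fpsC_is_monoid_morphism.

Lemma fpsXME0 f : (fpsX * f) 0%N = 0.
Proof. by rewrite fpsME big_ord1 mul0r. Qed.

Lemma fpsXMES f n : (fpsX * f) n.+1 = f n.
Proof.
rewrite fpsME big_ord_recl mul0r add0r big_ord_recl subSS subn0 mul1r big1 ?addr0 //.
by move=> i _; rewrite mul0r.
Qed.

Lemma fps_exp_low f : f 0%N = 0 -> forall k n, (n < k)%N -> (f ^+ k) n = 0.
Proof.
move=> f0; elim=> // k IH n ltnk; rewrite exprS fpsME big_ord_recl f0 mul0r add0r.
rewrite big1 // => i _; rewrite IH ?mulr0 // lift0.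
by have := ltn_ord i; move: ltnk; case: n i => [|n] i //; rewrite subSS;
   move=> lt1 lt2; apply: leq_ltn_trans (leq_subr _ _) _.
Qed.

Definition fps_deriv f : fps R := fun n => f n.+1 *+ n.+1.

Fact fps_deriv_is_additive : additive fps_deriv.
Proof. by move=> f g; apply: fpsP => n; rewrite /fps_deriv !fpsBE mulrnBl. Qed.

HB.instance Definition _ :=
  GRing.isZmodMorphism.Build (fps R) (fps R) fps_deriv fps_deriv_is_additive.

Lemma fps_derivC c : fps_deriv (fpsC c) = 0.
Proof. by apply: fpsP => n; rewrite /fps_deriv mul0rn. Qed.

Lemma fps_derivX : fps_deriv fpsX = 1.
Proof. by apply: fpsP => -[|n] //; rewrite /fps_deriv mul0rn. Qed.

Lemma fps_derivM f g :
  fps_deriv (f * g) = fps_deriv f * g + f * fps_deriv g.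
Proof.
apply: fpsP => n; pose N := n.+2.
have lti (i : 'I_n.+1) : (i.+1 < N)%N by rewrite !ltnS leq_ord.
have lts (i : 'I_n.+1) : ((n - i).+1 < N)%N by rewrite !ltnS leq_subr.
transitivity (((trunc N f * trunc N g)^`())`_n).
  by rewrite coef_deriv coef_truncM.
rewrite derivM coefD !coefM fpsDE !fpsME.
congr (_ + _); apply: eq_bigr => i _; rewrite coef_deriv !coef_trunc //.
  exact: ltnW (lts i).
exact: ltnW (lti i).
Qed.

Lemma fps_derivXn f k :
  fps_deriv (f ^+ k) = fps_deriv f * f ^+ k.-1 *+ k.
Proof.
elim: k => [|k IH]; first by rewrite mulr0n; exact: (fps_derivC 1).
rewrite exprS fps_derivM {}IH /= mulrnAr mulrCA mulrS.
by case: k => [|k]; rewrite ?mulr0n //= -exprS.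
Qed.

End Ring.

(** * Evaluation of the coefficients at x = z *)

Definition fps_eval (K : comNzRingType) (z : K) (f : fps {poly K}) : fps K :=
  fun n => (f n).[z].

Section Eval.
Variables (K : comNzRingType) (z : K).

Fact fps_eval_is_additive : additive (fps_eval z).
Proof. by move=> f g; apply: fpsP => n; rewrite /fps_eval !fpsBE hornerD hornerN. Qed.

Fact fps_eval_is_monoid_morphism : monoid_morphism (fps_eval z).
Proof.
split=> [|f g]; apply: fpsP => n; first by case: n => [|n]; rewrite /fps_eval ?hornerC.
by rewrite /fps_eval !fpsME horner_sum; apply: eq_bigr => i _; rewrite hornerM.
Qed.

HB.instance Definition _ :=
  GRing.isZmodMorphism.Build (fps {poly K}) (fps K) (fps_eval z) fps_eval_is_additive.
HB.instance Definition _ :=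
  GRing.isMonoidMorphism.Build (fps {poly K}) (fps K) (fps_eval z) fps_eval_is_monoid_morphism.

Lemma fps_evalC p : fps_eval z (fpsC p) = fpsC p.[z].
Proof. by apply: fpsP => -[|n] //; rewrite /fps_eval /= horner0. Qed.

End Eval.

(** * Powers f^y and their differential equation *)

Section Pow.
Variable K : numFieldType.
Implicit Types (f g h : fps K) (c y : K).

Lemma gbinomS y k : gbinom y k.+1 *+ k.+1 = (y - k%:R) * gbinom y k.
Proof.
rewrite /gbinom big_ord_recr /= factS natrM -mulr_natr.
have := pnatr_eq0 K k.+1; have := pnatr_eq0 K k`!.
rewrite eqn0Ngt fact_gt0 /= => /negbT k0 /negbT k1.
by field; rewrite k0 /= nat1r.
Qed.

(** As u^k starts at t^k, one bound N serves all n < N, and f^y can be differentiated as a finite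
    sum. *)
Lemma fps_powE f y (u := f - 1 : fps K) N n : u 0%N = 0 -> (n < N)%N ->
  fps_pow f y n = (\sum_(k < N) fpsC (gbinom y k) * u ^+ k) n.
Proof.
move=> u0 ltnN; rewrite fps_sumE /fps_pow.
pose v k := iter k (fps_mul (fps_sub f (fps_const 1))) (fps_const 1).
have vE k : v k = u ^+ k by elim: k => // k IH; rewrite /v iterS -/(v k) IH exprS.
rewrite (big_ord_widen N (fun k => gbinom y k * v k n)) //.
rewrite big_mkcond; apply: eq_bigr => k _; rewrite vE.
rewrite fpsCME; case: ltnP => // ltnk.
by rewrite fps_exp_low ?mulr0.
Qed.

Lemma fps_pow0 f y : fps_pow f y 0 = 1.
Proof. by rewrite /fps_pow big_ord1 /= mulr1 /gbinom big_ord0 fact0 divr1. Qed.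

(** One summand of f G' - y f' G for the truncated series G, with v = u' and b = binom(y, k). By
    [gbinomS] the bracket on the right is a difference of consecutive terms. *)
Lemma binomial_step (R : comNzRingType) (u v b y : R) k :
  (1 + u) * (b * (v * u ^+ k.-1 *+ k)) - y * (v * (b * u ^+ k)) =
  v * (b *+ k * u ^+ k.-1 - (y - k%:R) * b * u ^+ k).
Proof.
rewrite -[_ *+ k in LHS]mulr_natr -[b *+ k]mulr_natr.
by case: k => [|k] /=; rewrite ?exprS; ring.
Qed.

(* For u = f - 1, the difference of the two sides telescopes down to the last
   term of the truncated binomial series, a multiple of u^(n+1). *)
Lemma fps_pow_deriv f y : f 0%N = 1 ->
  f * fps_deriv (fps_pow f y) = fpsC y * (fps_deriv f * (fps_pow f y : fps K)).
Proof.
move=> f0; apply: fpsP => n; pose u : fps K := f - 1.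
have u0 : u 0%N = 0 by rewrite /u fpsBE f0 subrr.
(* The coefficient of t^n in a derivative reads the coefficient of t^(n+1), hence n + 2 terms. *)
pose N := n.+2; pose G := \sum_(k < N) fpsC (gbinom y k) * u ^+ k.
have EG i : (i < N)%N -> fps_pow f y i = G i by exact: fps_powE.
have fE : f = 1 + u by rewrite /u addrC subrK.
have fD : fps_deriv f = fps_deriv u.
  by rewrite fE raddfD /= (fps_derivC 1) add0r.
have lts (i : 'I_n.+1) : ((n - i).+1 < N)%N by rewrite !ltnS leq_subr.
transitivity ((f * fps_deriv G) n).
  by apply: eq_bigr => i _; congr (_ * _); rewrite /fps_deriv EG.
transitivity ((fpsC y * (fps_deriv f * G)) n); last first.
  rewrite !fpsCME; congr (_ * _).
  by apply: eq_bigr => i _; congr (_ * _); rewrite EG // ltnW.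
apply/eqP; rewrite -subr_eq0 -fpsBE; apply/eqP.
rewrite fD; have -> : f * fps_deriv G - fpsC y * (fps_deriv u * G) =
    - (fps_deriv u * fpsC (gbinom y N *+ N) * u ^+ n.+1).
  pose F k : fps K := fpsC (gbinom y k *+ k) * u ^+ k.-1.
  transitivity (fps_deriv u * \sum_(k < N) (F k - F k.+1)).
    rewrite /G raddf_sum /= !mulr_sumr -sumrB; apply: eq_bigr => k _.
    rewrite fps_derivM fps_derivC mul0r add0r fps_derivXn fE /F gbinomS /=.
    move: (gbinom y k) => b; rewrite (rmorphM (@fpsC K)) (rmorphB (@fpsC K)).
    rewrite (raddfMn (@fpsC K)) /= (rmorph_nat (@fpsC K)).
    exact: binomial_step.
  rewrite -(big_mkord xpredT (fun k => F k - F k.+1)).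
  rewrite (@telescope_sumr_eq _ 0 N (fun k => - F k)) // => [|k _]; last first.
    by rewrite opprK addrC.
  by rewrite {2}/F mulr0n rmorph0 mul0r opprK addr0 mulrN /F mulrA.
rewrite fpsNE fpsME big1 ?oppr0 // => i _.
by rewrite fps_exp_low ?mulr0 // ltnS leq_subr.
Qed.

(** The difference d solves the same linear equation. As f has constant term 1, comparing
    coefficients of t^n expresses (n+1) d_(n+1) through d_0, ..., d_n, so d vanishes by
    induction. *)
Lemma fps_pow_uniq f y (g h : fps K) : f 0%N = 1 -> g 0%N = h 0%N ->
  f * fps_deriv g = fpsC y * (fps_deriv f * g) ->
  f * fps_deriv h = fpsC y * (fps_deriv f * h) -> g = h.
Proof.
move=> f0 gh0 Dg Dh; apply/eqP; rewrite -subr_eq0; apply/eqP.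
set d := g - h.
have Dd : f * fps_deriv d = fpsC y * (fps_deriv f * d).
  by rewrite raddfB /= mulrBr Dg Dh /d; ring.
apply: fpsP => n; elim/ltn_ind: n => -[|n] IH; first by rewrite /d fpsBE gh0 subrr.
have := congr1 (fun s : fps K => s n) Dd; rewrite /= fpsCME !fpsME.
rewrite [in RHS]big1 ?mulr0 => [|i _]; last first.
  by rewrite IH ?mulr0 // ltnS leq_subr.
rewrite big_ord_recl f0 mul1r subn0 big1 ?addr0 => [|i _]; last first.
  rewrite /fps_deriv IH ?mul0rn ?mulr0 // lift0 ltnS.
  by case: n i {IH} => [[]//|n] i; rewrite subSS ltnS leq_subr.
by move/eqP; rewrite /fps_deriv mulrn_eq0 => /eqP.
Qed.

(** A square root g of f solves the equation of f^(1/2), because f' = 2 g g'. *)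
Lemma fps_pow_half f g : f 0%N = 1 -> g 0%N = 1 -> g ^+ 2 = f ->
  fps_pow f (1 / 2) = g.
Proof.
move=> f0 g0 gg; apply: (@fps_pow_uniq f (1 / 2)) => //.
- by rewrite fps_pow0.
- exact: fps_pow_deriv.
have half2 : fpsC (1 / 2) * 2%:R = 1 :> fps K.
  by rewrite -(rmorph_nat (@fpsC K)) -rmorphM /= divfK ?pnatr_eq0.
rewrite -[LHS]mul1r -half2 -gg fps_derivXn /=; move: (fpsC _) (fps_deriv g) => c g'.
by ring.
Qed.

End Pow.

(** * The derivation T on power series over K[x] *)

Section PDE.
Variable K : numFieldType.
Local Notation P := {poly K}.
Implicit Types (f g h : fps P) (p : P) (c : K).

Definition fps_derivx f : fps P := fun n => (f n)^`().

Fact fps_derivx_is_additive : additive fps_derivx.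
Proof. by move=> f g; apply: fpsP => n; rewrite /fps_derivx !fpsBE derivB. Qed.

HB.instance Definition _ :=
  GRing.isZmodMorphism.Build (fps P) (fps P) fps_derivx fps_derivx_is_additive.

Lemma fps_derivxM f g :
  fps_derivx (f * g) = fps_derivx f * g + f * fps_derivx g.
Proof.
apply: fpsP => n; rewrite fpsDE !fpsME -big_split /= /fps_derivx fpsME raddf_sum /=.
by apply: eq_bigr => i _; rewrite derivM.
Qed.

Lemma fps_derivxC p : fps_derivx (fpsC p) = fpsC p^`().
Proof. by apply: fpsP => -[|n] //; rewrite /fps_derivx /= deriv0. Qed.

(* The derivation T of the header. *)
Definition euler_op f : fps P :=
  (1 - fpsC 'X * fpsX _) * fps_deriv f - fpsC ('X * (1 - 'X)) * fps_derivx f.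

Fact euler_op_is_additive : additive euler_op.
Proof. by move=> f g; rewrite /euler_op !raddfB /=; ring. Qed.

HB.instance Definition _ :=
  GRing.isZmodMorphism.Build (fps P) (fps P) euler_op euler_op_is_additive.

Lemma euler_opM f g : euler_op (f * g) = euler_op f * g + f * euler_op g.
Proof. by rewrite /euler_op fps_derivM fps_derivxM; ring. Qed.

Lemma euler_opC p : euler_op (fpsC p) = - fpsC ('X * (1 - 'X) * p^`()).
Proof. by rewrite /euler_op fps_derivC fps_derivxC mulr0 sub0r -rmorphM. Qed.

Lemma euler_opE f n : euler_op f n =
  f n.+1 *+ n.+1 - 'X * f n *+ n - 'X * (1 - 'X) * (f n)^`().
Proof.
rewrite /euler_op mulrBl mul1r !fpsBE -[_ * fpsX _ * _]mulrA !fpsCME; congr (_ - _ - _).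
by case: n => [|n]; rewrite ?fpsXME0 ?fpsXMES ?mulr0 // /fps_deriv mulrnAr.
Qed.

(** The coefficient of t^n in T f is (n+1) f_(n+1) plus terms in f_n alone, so the equation
    propagates zero from the constant term. *)
Lemma euler_op_eq0 p f : euler_op f = fpsC p * f -> f 0%N = 0 -> f = 0.
Proof.
move=> Df f0; apply: fpsP; elim=> // n IH.
have := congr1 (fun s : fps P => s n) Df; rewrite /= euler_opE fpsCME IH.
rewrite deriv0 !mulr0 mul0rn !subr0 => /eqP.
by rewrite -scaler_nat scaler_eq0 pnatr_eq0 /= => /eqP.
Qed.

Lemma fps_deriv_eq0 f : fps_deriv f = 0 -> f 0%N = 0 -> f = 0.
Proof.
move=> Df f0; apply: fpsP => -[|n] //.
have /eqP := congr1 (fun s : fps P => s n) Df.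
by rewrite /= /fps_deriv -scaler_nat scaler_eq0 pnatr_eq0 /= => /eqP.
Qed.

(** The commutator comes from differentiating the factor 1 - xt; it gives access to T of an
    antiderivative. *)
Lemma fps_deriv_euler_op f :
  fps_deriv (euler_op f) = euler_op (fps_deriv f) - fpsC 'X * fps_deriv f.
Proof.
have DD : fps_deriv (fps_derivx f) = fps_derivx (fps_deriv f).
  by apply: fpsP => n; rewrite /fps_deriv /fps_derivx derivMn.
rewrite /euler_op raddfB /= !fps_derivM raddfB /= !fps_derivM !fps_derivC.
by rewrite fps_derivX DD; ring.
Qed.

Definition fps_expp p : fps P := fun n => n`!%:R^-1 *: p ^+ n.

Lemma factS_scale (V : lmodType K) n (v : V) :
  ((n.+1)`!%:R^-1 *: v) *+ n.+1 = n`!%:R^-1 *: v.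
Proof.
rewrite -scaler_nat scalerA factS natrM invfM mulrA divff ?mul1r //.
by rewrite pnatr_eq0.
Qed.

Lemma fps_expp_deriv p : fps_deriv (fps_expp p) = fpsC p * fps_expp p.
Proof.
by apply: fpsP => n; rewrite /fps_deriv factS_scale fpsCME exprS scalerAr.
Qed.

Lemma fps_expp_derivx p :
  fps_derivx (fps_expp p) = fpsC p^`() * (fpsX _ * fps_expp p).
Proof.
apply: fpsP => n; rewrite /fps_derivx fpsCME.
case: n => [|n]; first by rewrite /fps_expp expr0 fact0 invr1 scale1r derivC fpsXME0 mulr0.
rewrite fpsXMES /fps_expp derivZ deriv_exp /=.
by rewrite -scalerMnr factS_scale scalerAr.
Qed.


(** If p is a scalar multiple of 1 - x, then p + (1 - x) p' = 0, and e^{pt} is an eigenvector of T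
    with eigenvalue p. Both exponents used below have this form. *)
Lemma euler_op_expp p :
  euler_op (fps_expp p) =
  (fpsC p - (fpsC p + fpsC ((1 - 'X) * p^`())) * fpsC 'X * fpsX _) * fps_expp p.
Proof. by rewrite /euler_op fps_expp_deriv fps_expp_derivx !rmorphM /=; ring. Qed.

Definition fps_int f : fps P := fun n => if n is m.+1 then m.+1%:R^-1 *: f m else 0.

Lemma fps_intK f : fps_deriv (fps_int f) = f.
Proof.
apply: fpsP => n; rewrite /fps_deriv /fps_int -scaler_nat scalerA divff ?scale1r //.
by rewrite pnatr_eq0.
Qed.

(** * The generating functions Q and P *)

Let half : fps P := fpsC (1 / 2)%:P.

Lemma half_half : half + half = 1.
Proof.
rewrite -(raddfD (@fpsC P)) -polyCD -(rmorph1 (@fpsC P)); congr (fpsC _%:P).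
by field.
Qed.

(** The power of 2 absorbs the factor 2 in both recursions and leaves the inhomogeneous term of P
    halved. *)
Definition gf_coef n : K := (2 ^+ n * n`!%:R)^-1.

Lemma gf_coefS n : gf_coef n = 2 * (gf_coef n.+1 * n.+1%:R).
Proof.
rewrite /gf_coef exprS factS natrM.
have n1 : n.+1%:R != 0 :> K by rewrite pnatr_eq0.
have f1 : n`!%:R != 0 :> K by rewrite pnatr_eq0 eqn0Ngt fact_gt0.
have e1 : 2 ^+ n != 0 :> K by rewrite expf_neq0 ?pnatr_eq0.
by field; rewrite f1 e1 nat1r n1.
Qed.

Definition q_gf : fps P := fun n => gf_coef n *: q_pred K n.
Definition p_gf c : fps P := fun n => gf_coef n *: p_pred c n.

Lemma euler_op_q_gf : euler_op q_gf = half * q_gf.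
Proof.
apply: fpsP => n; rewrite euler_opE fpsCME /q_gf derivZ.
rewrite scalerMnl -mulr_natr [gf_coef n]gf_coefS.
set v := gf_coef n.+1 * n.+1%:R; rewrite mul_polyC scalerA.
have -> : 1 / 2 * (2 * v) = v by field.
rewrite /= -!mul_polyC !rmorphM /= !rmorph_nat; ring.
Qed.

Lemma euler_op_p_gf c :
  euler_op (p_gf c) = fpsC (c%:P * (1 - 'X)) * p_gf c + half * q_gf.
Proof.
apply: fpsP => n; rewrite euler_opE fpsDE !fpsCME /p_gf /q_gf derivZ.
rewrite scalerMnl -mulr_natr [gf_coef n]gf_coefS.
set v := gf_coef n.+1 * n.+1%:R; rewrite [(1 / 2)%:P * _]mul_polyC scalerA.
have -> : 1 / 2 * (2 * v) = v by field.
rewrite /= -!mul_polyC !rmorphM /= rmorphB /= !rmorph_nat; ring.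
Qed.

Lemma q_gf0 : q_gf 0%N = 1.
Proof. by rewrite /q_gf /gf_coef mul1r invr1 scale1r. Qed.

(** Under T, Q^2 has eigenvalue 1 and e^{t(x-1)} - x has eigenvalue x - 1, so their product has
    eigenvalue x, as 1 - x does. The denominator stays on the left because its constant term 1 - x
    is not a unit of K[x]. *)
Lemma q_gf_sqr :
  q_gf ^+ 2 * (fps_expp ('X - 1) - fpsC 'X) = fpsC (1 - 'X).
Proof.
apply/eqP; rewrite -subr_eq0; apply/eqP.
apply: (@euler_op_eq0 'X); last first.
  rewrite fpsBE fpsME big_ord1 /= expr2 fpsME big_ord1 /= q_gf0.
  by rewrite fpsBE /fps_expp /= invr1 scale1r !mul1r subrr.
rewrite raddfB /= expr2 !euler_opM raddfB /= euler_op_q_gf euler_op_expp !euler_opC.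
rewrite !derivB !derivX derivC sub0r subr0 !mulr1 mulrN1 rmorphN opprK.
rewrite !rmorphM /= !rmorphB /= rmorph1.
move: (fps_expp _) (fpsC 'X) half_half => e x.
set h := half; set q := q_gf => hh.
have -> : (h * q * q + q * (h * q)) = q * q by rewrite mulrAC mulrCA -!mulrA -mulrDl hh mul1r.
by ring.
Qed.

Section Convolution.
Variable c : K.

(** The integrand of J in the header; the variable [c] here is the parameter a there. *)
Let B : fps P := q_gf * fps_expp ((c - 1)%:P * (1 - 'X)).

(** The eigenvalue 1/2 + (c - 1)(1 - x) is split so that its summand x cancels the commutator term
    of [fps_deriv_euler_op]. *)
Lemma euler_op_convolution :
  euler_op B = fpsC (c%:P * (1 - 'X)) * B + (fpsC 'X - half) * B.
Proof.
rewrite /B euler_opM euler_op_q_gf euler_op_expp.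
rewrite derivM derivC derivB derivC derivX mul0r add0r sub0r.
rewrite !rmorphM !rmorphB /= !rmorph1 rmorphN rmorph1.
have hE : half = 1 - half by rewrite -half_half addrK.
rewrite {1}hE.
by rewrite /=; move: half (fpsC c%:P) (fpsC 'X) => h C x; ring.
Qed.

(** The two sides have the same t-derivative, by the previous lemma. The summand 1 is the constant
    term of T J, which is the constant term of [B]. *)
Lemma euler_op_int_convolution :
  euler_op (fps_int B) = (fpsC (c%:P * (1 - 'X)) - half) * fps_int B + 1.
Proof.
apply/eqP; rewrite -subr_eq0; apply/eqP; apply: fps_deriv_eq0.
  rewrite (raddfB (@fps_deriv P)) /= fps_deriv_euler_op.
  rewrite (raddfD (@fps_deriv P)) /= fps_derivM.
  rewrite (raddfB (@fps_deriv P)) /= !fps_derivC fps_intK euler_op_convolution.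
  by ring.
rewrite fpsBE fpsDE euler_opE fpsME big_ord1 /= deriv0 !mulr0 mulr0n !subr0 add0r.
rewrite invr1 scale1r /B fpsME big_ord1 q_gf0 mul1r /fps_expp expr0 fact0 invr1 scale1r.
by rewrite subrr.
Qed.

(** In T (J Q) the -1/2 from J cancels the 1/2 from Q, and the summand 1 yields the inhomogeneous
    term. Both sides have constant term 0, as p_{-1} = 0. *)
Lemma p_gfE : p_gf c = half * (fps_int B * q_gf).
Proof.
apply/eqP; rewrite -subr_eq0; apply/eqP.
apply: (@euler_op_eq0 (c%:P * (1 - 'X))); last first.
  by rewrite fpsBE /p_gf scaler0 fpsCME fpsME big_ord1 mul0r mulr0 subrr.
rewrite raddfB /= euler_op_p_gf !euler_opM euler_op_q_gf euler_op_int_convolution.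
rewrite euler_opC derivC mulr0 rmorph0 oppr0 mul0r add0r.
by ring.
Qed.

End Convolution.

End PDE.

(** * Evaluation at z and extraction of coefficients *)

Section Main.
Variable K : numFieldType.
Implicit Types (a z : K).

Lemma horner_expp (p : {poly K}) z n :
  (fps_expp p n).[z] = n`!%:R^-1 * p.[z] ^+ n.
Proof. by rewrite /fps_expp hornerZ horner_exp. Qed.

(** For z != 1 the denominator has the invertible constant term 1 - z, so [q_gf_sqr] evaluated at z
    exhibits Q as the square root in the definition. *)
Lemma eulerian_half n z : z != 1 ->
  eulerian n z (1 / 2) = n`!%:R * (q_gf K n).[z].
Proof.
move=> z1; rewrite /eulerian; congr (_ * _).
pose s : fps K := fps_sub (fps_exp (z - 1)) (fps_const z).
pose r : fps K := fps_inv s.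
have sE : fps_eval z (fps_expp ('X - 1) - fpsC 'X) = s.
  apply: fpsP => m; rewrite /fps_eval fpsBE hornerD hornerN horner_expp.
  rewrite !hornerE /s /fps_sub /fps_exp mulrC.
  by case: m => [|m]; rewrite /= ?hornerE.
have s0 : s 0%N != 0.
  by rewrite /s /fps_sub /fps_exp /= divr1 subr_eq0 eq_sym.
have rs : r * s = 1 by apply: fpsP => m; exact: fps_mulVf.
pose q := fps_eval z (q_gf K).
have qq : q ^+ 2 = fpsC (1 - z) * r.
  rewrite -[LHS]mulr1 -rs mulrCA [r * _]mulrC -sE -rmorphXn -rmorphM q_gf_sqr.
  by rewrite /= fps_evalC !hornerE.
have q0 : q 0%N = 1 by rewrite /q /fps_eval q_gf0 hornerC.
rewrite /eulerian_gf -/s.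
have -> : fps_div (fps_const (1 - z)) s = q ^+ 2 by rewrite qq.
rewrite (@fps_pow_half _ _ q) //.
by rewrite expr2 fpsME big_ord1 q0 mulr1.
Qed.

(** On the left, (n+1)! undoes the normalization of P, 1/(j+1) comes from integration and 1/(j-l)!
    from the exponential; on the right, (n-j)! and l! normalize the two Eulerian factors. *)
Lemma fact_ratio n j l : (l <= j <= n)%N ->
  (n.+1)`!%:R * j.+1%:R^-1 * (j - l)`!%:R^-1 =
  'C(n.+1, j.+1)%:R * 'C(j, l)%:R * (n - j)`!%:R * l`!%:R :> K.
Proof.
case/andP=> lj jn.
have F m : m`!%:R != 0 :> K by rewrite pnatr_eq0 eqn0Ngt fact_gt0.
have S : j.+1%:R != 0 :> K by rewrite pnatr_eq0.
rewrite -(@bin_fact n.+1 j.+1) // subSS factS -(@bin_fact j l) // !natrM.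
by field; rewrite nat1r S F.
Qed.

Lemma p_poly_eulerian a z n : z != 1 ->
  (p_poly a n).[z] =
  2 ^+ n * \sum_(0 <= j < n.+1) \sum_(0 <= l < j.+1)
    'C(n.+1, j.+1)%:R * 'C(j, l)%:R * (a - 1) ^+ (j - l)
    * (1 - z) ^+ (j - l) * eulerian (n - j) z (1 / 2) * eulerian l z (1 / 2).
Proof.
move=> z1.
have F : (n.+1)`!%:R != 0 :> K by rewrite pnatr_eq0 eqn0Ngt fact_gt0.
have E2 : 2 ^+ n != 0 :> K by rewrite expf_neq0 ?pnatr_eq0.
(* p_n sits at t^(n+1) in P, with weight 1/(2^(n+1) (n+1)!); the extra 2 cancels the 1/2 of
   [p_gfE]. *)
have -> : (p_poly a n).[z] = 2 ^+ n * ((n.+1)`!%:R * (2 * (p_gf a n.+1).[z])).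
  rewrite /p_gf hornerZ /gf_coef exprS /p_poly.
  by field; rewrite E2 F.
congr (_ * _); rewrite p_gfE fpsCME hornerCM.
have two_half (x : K) : 2 * (1 / 2 * x) = x by field.
rewrite two_half.
(* J has no constant term; its coefficient of t^(j+1) meets that of t^(n-j) in Q. *)
rewrite fpsME big_ord_recl mul0r add0r horner_sum mulr_sumr big_mkord.
apply: eq_bigr => j _; rewrite lift0 subSS big_mkord.
rewrite hornerM hornerZ fpsME horner_sum !mulr_sumr mulr_suml mulr_sumr.
apply: eq_bigr => l _; rewrite !eulerian_half // hornerM horner_expp.
have e : (n.+1)`!%:R * j.+1%:R^-1 * (j - l)`!%:R^-1 =
    'C(n.+1, j.+1)%:R * 'C(j, l)%:R * (n - j)`!%:R * l`!%:R :> K.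
  by apply: fact_ratio; rewrite !leq_ord.
have -> : ((a - 1)%:P * (1 - 'X)).[z] = (a - 1) * (1 - z) by rewrite !hornerE.
rewrite exprMn; move: (q_gf K _).[z] (q_gf K l).[z] => qj ql.
transitivity ((n.+1)`!%:R * j.+1%:R^-1 * (j - l)`!%:R^-1 * (a - 1) ^+ (j - l)
  * (1 - z) ^+ (j - l) * qj * ql); first by ring.
by rewrite e; ring.
Qed.

End Main.

Unset Implicit Arguments.
Set Strict Implicit.

Theorem theorem3p4 (R : realType) (n : nat) (a : R) (z : R[i])
    (ha : forall k : int, k <= 1 -> a <> k%:~R / 2)
    (hz : `|z| < 1) :
  (p_poly a%:C n).[z] =
  2 ^+ n * \sum_(0 <= j < n.+1) \sum_(0 <= l < j.+1)
    'C(n.+1, j.+1)%:R * 'C(j, l)%:R * (a%:C - 1) ^+ (j - l)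
    * (1 - z) ^+ (j - l) * eulerian (n - j) z (1 / 2) * eulerian l z (1 / 2).
Proof.
apply: p_poly_eulerian; apply: contraTneq hz => ->.
by rewrite normr1 Order.POrderTheory.ltxx.
Qed.
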